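(* Let $X$ and $Y$ be independent random variables with $0<P\{Y>0\}\le P\{Y\ge0\}=1$, let $(X_i,Y_i)$, $i\ge1$, be i.i.d. copies of $(X,Y)$, and let $T_n=\sum_{i=1}^nX_iY_i/\sum_{i=1}^nY_i$ (with $0/0:=0$). Assume that $E|X|<\infty$ and that the condition $$\limsup_{x\to\infty}\frac{xE\left(YI(Y\le x)\right)}{x^2P\{Y>x\}+EY^2I(Y\le x)}<\infty$$ does not hold. Then there exist a subsequence $\{n'\}$ of $\{n\}$ and a random variable $T$ such that $$T_{n'}\overset{\mathrm{D}}{\longrightarrow}T,\qquad\text{where } P\{T=EX\}>0.$$ *)

(* Defs.v *)
From HB Require Import structures.
From mathcomp Require Import all_boot all_order all_algebra finmap.
From mathcomp Require Import all_classical all_reals all_analysis.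
From mathcomp Require Import measurable_realfun.

Set Implicit Arguments.
Unset Strict Implicit.
Unset Printing Implicit Defensive.

Import Order.TTheory GRing.Theory Num.Theory.
Import numFieldNormedType.Exports.

Local Open Scope classical_set_scope.
Local Open Scope ring_scope.

Lemma measurable_pairRV d d1 d2 (T : measurableType d) (T1 : measurableType d1)
    (T2 : measurableType d2) (X : {mfun T >-> T1}) (Y : {mfun T >-> T2}) :
  measurable_fun [set: T] (fun w => (X w, Y w)).
Proof. exact: measurable_fun_pair. Qed.

Definition pairRV d d1 d2 (T : measurableType d) (T1 : measurableType d1)
    (T2 : measurableType d2) (R : realType) (P : probability T R)
    (X : {RV P >-> T1}) (Y : {RV P >-> T2}) : {RV P >-> (T1 * T2)%type} :=
  HB.pack (fun w => (X w, Y w))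
    (isMeasurableFun.Build _ _ _ _ _ (measurable_pairRV X Y)).

Definition independent2 d d1 d2 (T : measurableType d) (T1 : measurableType d1)
    (T2 : measurableType d2) (R : realType) (P : probability T R)
    (X : {RV P >-> T1}) (Y : {RV P >-> T2}) :=
  forall A B, measurable A -> measurable B ->
    P ((X @^-1` A) `&` (Y @^-1` B)) = (P (X @^-1` A) * P (Y @^-1` B))%E.

Definition mutually_independent d d' (T : measurableType d)
    (T' : measurableType d') (R : realType) (P : probability T R)
    (I : choiceType) (Z : I -> {RV P >-> T'}) :=
  forall (J : {fset I}) (A : I -> set T'), (forall i, measurable (A i)) ->
    P (\bigcap_(i in [set` J]) (Z i @^-1` A i)) =
    (\prod_(i <- J) P (Z i @^-1` A i))%E.

(* Equality only on measurable sets: a measure is a function on all sets, with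
   unspecified values on the non-measurable ones. *)
Definition identically_distributed d1 d2 d' (T1 : measurableType d1)
    (T2 : measurableType d2) (T' : measurableType d') (R : realType)
    (P1 : probability T1 R) (P2 : probability T2 R)
    (Z1 : {RV P1 >-> T'}) (Z2 : {RV P2 >-> T'}) :=
  forall A, measurable A -> distribution P1 Z1 A = distribution P2 Z2 A.

Definition iid_copies d d' (T : measurableType d) (T' : measurableType d')
    (R : realType) (P : probability T R)
    (Z_ : nat -> {RV P >-> T'}) (Z : {RV P >-> T'}) :=
  mutually_independent Z_ /\ forall i, identically_distributed (Z_ i) Z.

Definition cvg_in_distribution d d' (T : measurableType d)
    (T' : measurableType d') (R : realType) (P : probability T R)
    (P' : probability T' R) (S : nat -> {RV P >-> R}) (Z : {RV P' >-> R}) :=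
  forall x : R, {for x, continuous (cdf Z)} -> cdf (S n) x @[n --> \oo] --> cdf Z x.

(* X_1, X_2, ... are indexed from 0; the convention 0 / 0 = 0 is the one of
   MathComp's total inverse, for which 0^-1 = 0. *)
Definition weighted_mean (T : Type) (R : realType) (X Y : nat -> T -> R)
    (n : nat) (w : T) : R :=
  (\sum_(i < n) X i w * Y i w) / \sum_(i < n) Y i w.

Lemma measurable_inv_real (R : realType) :
  measurable_fun [set: R] (fun x : R => x^-1).
Proof.
have oN0 : open (~` [set (0 : R)]).
  by rewrite openC; apply: accessible_closed_set1; exact: hausdorff_accessible.
rewrite -(setUv [set (0 : R)]); apply/measurable_funU => //.
  exact: open_measurable.
split; first exact: measurable_fun_set1.
apply: open_continuous_measurable_fun => // x; rewrite inE /= => /eqP.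
exact: inv_continuous.
Qed.

Lemma measurable_weighted_mean d (T : measurableType d) (R : realType)
    (X Y : nat -> {mfun T >-> R}) (n : nat) :
  measurable_fun [set: T] (weighted_mean (fun i => X i) (fun i => Y i) n).
Proof.
apply: measurable_funM.
  by apply: measurable_sum => i; exact: measurable_funM.
by apply: measurableT_comp; [exact: measurable_inv_real|exact: measurable_sum].
Qed.

Definition weighted_meanRV d (T : measurableType d) (R : realType)
    (P : probability T R) (X Y : nat -> {RV P >-> R}) (n : nat) : {RV P >-> R} :=
  HB.pack (weighted_mean (fun i => X i) (fun i => Y i) n)
    (isMeasurableFun.Build _ _ _ _ _ (measurable_weighted_mean X Y n)).

(* Both truncated moments and the tail probability are finite when Y >= 0 almost
   surely, so that no information is lost by [fine]; when moreover
   0 < P[Y > 0], the denominator is positive for x > 0. *)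
Definition truncation_ratio d (T : measurableType d) (R : realType)
    (P : probability T R) (Y : {RV P >-> R}) (x : R) : R :=
  (x * fine 'E_P[fun w => Y w * \1_[set v | Y v <= x] w]) /
  (x ^+ 2 * fine (P [set w | Y w > x]) +
   fine 'E_P[fun w => Y w ^+ 2 * \1_[set v | Y v <= x] w]).

Definition ratio_limsup_finite d (T : measurableType d) (R : realType)
    (P : probability T R) (Y : {RV P >-> R}) :=
  (limf_esup (fun x : R => (truncation_ratio Y x)%:E) +oo%R < +oo)%E.

(* Main.v *)
(* The limit can be taken to be the constant EX. Let D(x) = E min(Y, x)^2 and
   a(x) = E[Y; Y <= x], so that the ratio is r = x a / D, and pick x with r large.
   Since a^2 <= D, x^2 / D >= r^2, so n ~ c x^2 / D is large even for a small c.
   - n P(Y > x) <= n D / x^2 ~ c: with probability close to 1 none of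
     Y_1, ..., Y_n exceeds x, and they may be truncated at x.
   - D / (n a^2) ~ 1 / (c r^2) is small: by Chebyshev's inequality the truncated
     weights sum to about n a, and no single one matters. Splitting X - EX into
     a bounded centered part (second moments) and a part small in L^1 (Markov's
     inequality), the weighted mean is close to EX.
   Hence the weighted means get close to EX in probability infinitely often. *)
Require Import Defs.
From HB Require Import structures.
From mathcomp Require Import all_boot all_order all_algebra finmap.
From mathcomp Require Import all_classical all_reals all_analysis.
From mathcomp Require Import measurable_realfun.
From mathcomp Require Import ring lra.

Set Implicit Arguments.
Unset Strict Implicit.
Unset Printing Implicit Defensive.

Import Order.TTheory GRing.Theory Num.Theory.
Import numFieldNormedType.Exports.

Local Open Scope classical_set_scope.
Local Open Scope ring_scope.

(** * Expectation of a product of functions of two independent variables *)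

Section independence.
Context d (Omega : measurableType d) (R : realType) (P : probability Omega R).

Section product.
Context d1 d2 (T1 : measurableType d1) (T2 : measurableType d2).
Variables (Z1 : {RV P >-> T1}) (Z2 : {RV P >-> T2}).
Hypothesis Z12 : independent2 Z1 Z2.

(** Independence says that the two measures agree on measurable rectangles, and these determine a
    product measure. *)
Lemma distribution_pairRV (A : set (T1 * T2)) : measurable A ->
  (distribution P Z1 \x distribution P Z2)%E A =
  distribution P (pairRV Z1 Z2) A.
Proof.
apply: product_measure_unique => B C mB mC.
by rewrite /distribution/= /pushforward/= -Z12.
Qed.

Variables (f : T1 -> R) (g : T2 -> R).
Hypotheses (mf : measurable_fun setT f) (mg : measurable_fun setT g).
Hypothesis intf : P.-integrable setT (EFin \o (f \o Z1)).
Hypothesis intg : P.-integrable setT (EFin \o (g \o Z2)).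

Let h (z : T1 * T2) : \bar R := (f z.1 * g z.2)%:E.

Let mh : measurable_fun setT h.
Proof.
apply/measurable_EFinP; apply: measurable_funM.
  exact: (measurableT_comp mf).
exact: (measurableT_comp mg).
Qed.

Let intf1 : (distribution P Z1).-integrable setT (EFin \o f).
Proof. by apply: integrable_pushforward => //; exact/measurable_EFinP. Qed.

Let intg2 : (distribution P Z2).-integrable setT (EFin \o g).
Proof. by apply: integrable_pushforward => //; exact/measurable_EFinP. Qed.

(** By Tonelli: the inner integral of [|g|] is a finite constant, which factors out of the outer
    integral of [|f|]. *)
Let inth : (distribution P Z1 \x distribution P Z2)%E.-integrable setT h.
Proof.
apply/integrable12ltyP => //.
have -> : (\int[distribution P Z1]_x \int[distribution P Z2]_y `|h (x, y)| =
   \int[distribution P Z1]_x ((`|f x|)%:E * \int[distribution P Z2]_y (`|g y|)%:E))%E.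
  apply: eq_integral => x _; rewrite -integralZl//.
    by apply: eq_integral => y _; rewrite /h/= normrM EFinM.
  exact: integrable_norm.
have /fineK <- : (\int[distribution P Z2]_y (`|g y|)%:E)%E \is a fin_num.
  by apply: integrable_fin_num => //; exact: integrable_norm.
apply: integrable_lty => //.
by apply: (integrableZr _ _ (integrable_norm intf1)).
Qed.

Lemma independent_integrableM :
  P.-integrable setT (fun w => (f (Z1 w) * g (Z2 w))%:E).
Proof.
apply/integrableP; split.
  exact: (measurableT_comp mh (measurable_pairRV Z1 Z2)).
have /integrableP[_] := inth.
rewrite (eq_measure_integral (distribution P (pairRV Z1 Z2))); last first.
  by move=> A mA _; exact: distribution_pairRV.
by rewrite ge0_integral_distribution//; exact: measurableT_comp.
Qed.

(** After transport to the product of the two laws, Fubini's theorem splits the integral. *)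
Lemma independent_RintegralM :
  \int[P]_w (f (Z1 w) * g (Z2 w)) =
  (\int[P]_w f (Z1 w)) * \int[P]_w g (Z2 w).
Proof.
rewrite /Rintegral -fineM; [|exact: integrable_fin_num..]; congr fine.
have -> : (\int[P]_w (f (Z1 w) * g (Z2 w))%:E =
           \int[distribution P (pairRV Z1 Z2)]_z h z)%E.
  by rewrite integral_distribution//; exact: independent_integrableM.
rewrite (eq_measure_integral (distribution P Z1 \x distribution P Z2)%E); last first.
  by move=> A mA _; exact/esym/distribution_pairRV.
rewrite -integral12_prod_meas1// /fubini_F.
rewrite -(integral_distribution (measurableT_comp _ mf))//.
rewrite -(integral_distribution (measurableT_comp _ mg))//.
have /fineK <- : (\int[distribution P Z2]_y (EFin \o g) y)%E \is a fin_num.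
  exact: integrable_fin_num.
rewrite -integralZr//; apply: eq_integral => x _.
rewrite fineK; last exact: integrable_fin_num.
by rewrite -integralZl//.
Qed.

End product.
End independence.

(** * Integrability of bounded functions and Markov's inequality *)

Section moments.
Context d (Omega : measurableType d) (R : realType) (P : probability Omega R).

Lemma bounded_integrable (f : Omega -> R) (K : R) :
  measurable_fun setT f -> (forall w, `|f w| <= K) ->
  P.-integrable setT (EFin \o f).
Proof.
move=> mf fK; apply: measurable_bounded_integrable => //.
  by rewrite -ge0_fin_numE ?measure_ge0// fin_num_measure.
exists K; split; first exact: num_real.
by move=> x Kx w _ /=; rewrite (le_trans (fK w))// ltW.
Qed.

Lemma markov_Rintegral (f : Omega -> R) (t : R) :
  P.-integrable setT (EFin \o f) -> (forall w, 0 <= f w) -> 0 < t ->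
  (P [set w | (t <= f w)%R] <= (\int[P]_w f w / t)%:E)%E.
Proof.
move=> intf f0 t0.
have := @le_integral_comp_abse _ _ _ P _ measurableT (EFin \o f) t id
  (@measurable_id _ _ _) (fun _ => id) (fun _ _ _ _ => id) (measurable_int _ intf) t0.
rewrite setTI.
have -> : [set w | (t%:E <= `|(EFin \o f) w|)%E] = [set w | t <= f w].
  by apply: eq_set => w; rewrite /= lee_fin ger0_norm.
have -> : (\int[P]_w `|(EFin \o f) w| = (\int[P]_w f w)%:E)%E.
  rewrite /Rintegral fineK; last exact: integrable_fin_num.
  by apply: eq_integral => w _; rewrite /= ger0_norm.
by rewrite muleC -lee_pdivlMr// EFinM.
Qed.

End moments.

(** * Transfer of integrals between identically distributed variables *)

Section identical_distribution.
Context d1 d2 d' (T1 : measurableType d1) (T2 : measurableType d2)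
  (T' : measurableType d') (R : realType).
Variables (P1 : probability T1 R) (P2 : probability T2 R).
Variables (Z1 : {RV P1 >-> T'}) (Z2 : {RV P2 >-> T'}).
Hypothesis Z12 : identically_distributed Z1 Z2.
Variable h : T' -> R.
Hypothesis mh : measurable_fun setT h.
Hypothesis inth : P2.-integrable setT (EFin \o (h \o Z2)).

(** Both integrals of [|h|] are integrals against the laws, and an integral depends only on the
    values of the measure on measurable sets, where the two laws agree. *)
Lemma identically_distributed_integrable :
  P1.-integrable setT (EFin \o (h \o Z1)).
Proof.
have mhE : measurable_fun setT (EFin \o h) by exact/measurable_EFinP.
apply/integrableP; split.
  apply/measurable_EFinP; exact: (measurableT_comp mh).
have /integrableP[_] := inth.
have mah : measurable_fun setT (abse \o (EFin \o h)) by exact: measurableT_comp.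
have ah0 y : (0 <= (abse \o (EFin \o h)) y)%E by exact: abse_ge0.
have <- := @ge0_integral_distribution _ _ _ _ _ P2 Z2 _ mah ah0.
have <- := @ge0_integral_distribution _ _ _ _ _ P1 Z1 _ mah ah0.
rewrite (eq_measure_integral (distribution P1 Z1))// => A mA _.
exact/esym/Z12.
Qed.

Lemma identically_distributed_Rintegral :
  \int[P1]_w h (Z1 w) = \int[P2]_w h (Z2 w).
Proof.
have mhE : measurable_fun setT (EFin \o h) by exact/measurable_EFinP.
congr fine.
have E1 := integral_distribution mhE identically_distributed_integrable.
have E2 := integral_distribution mhE inth.
rewrite -[LHS]E1 -[RHS]E2; apply: eq_measure_integral => A mA _.
exact: Z12.
Qed.

End identical_distribution.

(** * Chebyshev's inequality for sums of i.i.d. centered bounded terms *)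

Section second_moment.
Context d (Omega : measurableType d) (R : realType) (P : probability Omega R).

Lemma Rintegral_sum (I : Type) (s : seq I) (f : I -> Omega -> R) :
  (forall i, P.-integrable setT (EFin \o f i)) ->
  \int[P]_w (\sum_(i <- s) f i w) = \sum_(i <- s) \int[P]_w f i w.
Proof.
move=> intf; elim: s => [|i s IHs].
  rewrite big_nil (@eq_Rintegral _ _ _ P setT (cst 0)) ?Rintegral_cst ?mul0r//.
  by move=> w _; rewrite big_nil.
rewrite big_cons -IHs -RintegralD//.
  by apply: eq_Rintegral => w _; rewrite big_cons.
rewrite (_ : _ \o _ = (fun w => \sum_(j <- s) (f j w)%:E)%E).
  by apply: integrable_sum => // i' _; exact: intf.
by apply/funext => w /=; rewrite sumEFin.
Qed.

Context d' (T' : measurableType d').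
Variables (Z_ : nat -> {RV P >-> T'}) (Z : {RV P >-> T'}).

Lemma mutually_independent_pair i j : mutually_independent Z_ -> i != j ->
  independent2 (Z_ i) (Z_ j).
Proof.
move=> indep ij A B mA mB.
(* Only the indices [i] and [j] enter the intersection, so every index other than [i] may be given
   the event [B]. *)
have /(_ [fset i; j]%fset) := indep _ (fun k => if k == i then A else B).
rewrite big_fsetU1/= ?inE// big_seq_fset1 eqxx eq_sym (negbTE ij) => <-.
  congr (P _); apply/seteqP; split => w /=.
    by move=> [Aw Bw] k /=; rewrite !inE => /orP[]/eqP ->; rewrite ?eqxx// eq_sym (negbTE ij).
  move=> H; split.
    by have := H i; rewrite /= !inE eqxx => /(_ isT).
  by have := H j; rewrite /= !inE eqxx orbT eq_sym (negbTE ij) => /(_ isT).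
by move=> k; case: ifP.
Qed.

(** Markov's inequality for the squared sum: by pairwise independence and centering the cross terms
    vanish, and the [n] diagonal terms remain. The bound [K] supplies the integrability of all
    products. *)
Lemma iid_sum_deviation (h : T' -> R) (K : R) (n : nat) (t : R) :
  iid_copies Z_ Z ->
  measurable_fun setT h -> (forall z, `|h z| <= K) ->
  \int[P]_w h (Z w) = 0 -> 0 < t ->
  (P [set w | (t <= `|\sum_(i < n) h (Z_ i w)|)%R] <=
   (n%:R * \int[P]_w (h (Z w) ^+ 2) / t ^+ 2)%:E)%E.
Proof.
move=> [indep iden] mh hK h0 t0.
have mhZ (V : {RV P >-> T'}) : measurable_fun setT (h \o V).
  exact: measurableT_comp.
have inthZ (V : {RV P >-> T'}) : P.-integrable setT (EFin \o (h \o V)).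
  by apply: bounded_integrable => // w; exact: hK.
have inthh (V W : {RV P >-> T'}) :
    P.-integrable setT (EFin \o (fun w => h (V w) * h (W w))).
  apply: (@bounded_integrable _ _ _ _ _ (K * K)).
    by apply: measurable_funM; exact: mhZ.
  by move=> w; rewrite normrM ler_pM.
have cross (i j : 'I_n) : \int[P]_w (h (Z_ i w) * h (Z_ j w)) =
    if i == j then \int[P]_w (h (Z w) ^+ 2) else 0.
  case: eqP => [->|/eqP ij].
    rewrite (@identically_distributed_Rintegral _ _ _ _ _ _ _ _ _ _ _ (iden j)
      (fun z => h z * h z)) //; last exact: inthh.
    exact: measurable_funM.
  rewrite (@independent_RintegralM _ _ _ _ _ _ _ _ _ _
    (mutually_independent_pair indep ij))//.
  by rewrite (identically_distributed_Rintegral (iden i))// h0 mul0r.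
have sumsq w : (\sum_(i < n) h (Z_ i w)) ^+ 2 =
    \sum_(i < n) \sum_(j < n) h (Z_ i w) * h (Z_ j w).
  by rewrite expr2 mulr_suml; apply: eq_bigr => i _; rewrite mulr_sumr.
have intsum (i : 'I_n) :
    P.-integrable setT (EFin \o (fun w => \sum_(j < n) h (Z_ i w) * h (Z_ j w))).
  rewrite (_ : _ \o _ = (fun w => \sum_(j < n) (h (Z_ i w) * h (Z_ j w))%:E)%E).
    by apply: integrable_sum => // j _; exact: inthh.
  by apply/funext => w /=; rewrite sumEFin.
have intsq :
    P.-integrable setT (EFin \o (fun w => (\sum_(i < n) h (Z_ i w)) ^+ 2)).
  rewrite (_ : _ \o _ = (fun w => \sum_(i < n) (\sum_(j < n) h (Z_ i w) * h (Z_ j w))%:E)%E).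
    by apply: integrable_sum => // j _; exact: intsum.
  by apply/funext => w /=; rewrite sumsq sumEFin.
have -> : [set w | t <= `|\sum_(i < n) h (Z_ i w)|] =
    [set w | t ^+ 2 <= (\sum_(i < n) h (Z_ i w)) ^+ 2].
  apply: eq_set => w; congr is_true.
  by rewrite -[X in _ = (_ <= X)]real_normK ?num_real// ler_sqr// nnegrE ltW.
have -> : n%:R * \int[P]_w (h (Z w) ^+ 2) =
    \int[P]_w ((\sum_(i < n) h (Z_ i w)) ^+ 2).
  under [RHS]eq_Rintegral do rewrite sumsq.
  rewrite Rintegral_sum//.
  under [RHS]eq_bigr do rewrite Rintegral_sum//.
  under [RHS]eq_bigr => i _.
    under eq_bigr do rewrite cross.
    rewrite -big_mkcond/= (big_pred1 i); last by move=> j; rewrite /= eq_sym.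
    over.
  by rewrite sumr_const card_ord mulr_natl.

apply: (markov_Rintegral intsq) => [w|]; rewrite ?sqr_ge0 ?exprn_gt0//.
Qed.

End second_moment.

(** * Splitting [X - EX] into a bounded centered part and a part small in L^1 *)

Section truncation.
Context d (Omega : measurableType d) (R : realType) (P : probability Omega R).

Lemma Rintegral_probability_cst (c : R) : \int[P]_w c = c.
Proof. by have := expectation_cst P c; rewrite /Rintegral unlock => ->. Qed.

(** [u] is a recentered truncation at a high level and [q] is what remains, small in L^1 by
    dominated convergence. Both are functions on the reals rather than random variables, so that
    they can be applied to every copy of [X]. *)
Lemma centered_decomposition (X : {RV P >-> R}) (delta : R) :
  P.-integrable setT (EFin \o X) -> 0 < delta ->
  exists (K : R) (u q : R -> R),
    [/\ measurable_fun setT u, measurable_fun setT q,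
        (forall x, x - \int[P]_w X w = u x + q x),
        (forall x, `|u x| <= K) /\ \int[P]_w u (X w) = 0 &
        P.-integrable setT (EFin \o (q \o X)) /\
        \int[P]_w `|q (X w)| <= delta].
Proof.
move=> intX delta0.
pose phi (n : nat) (x : R) := x * \1_[set y : R | `|y| <= n%:R] x.
have mset n : measurable [set y : R | `|y| <= n%:R].
  rewrite -[X in measurable X]setTI.
  by apply: measurable_fun_le => //; exact: measurableT_comp.
have mphi n : measurable_fun setT (phi n).
  by apply: measurable_funM => //; exact: measurable_indic.
have phiE n x : `|x| <= n%:R -> phi n x = x.
  by move=> xn; rewrite /phi indicE mem_set//= mulr1.
have phi0 n x : ~ `|x| <= n%:R -> phi n x = 0.
  by move=> xn; rewrite /phi indicE memNset//= mulr0.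
have phi_le n x : `|phi n x| <= `|x|.
  by have [/phiE ->//|/negP/phi0 ->] := boolP (`|x| <= n%:R); rewrite normr0.
have phi_bnd n x : `|phi n x| <= n%:R.
  by have [/[dup] ? /phiE ->//|/negP/phi0 ->] := boolP (`|x| <= n%:R); rewrite normr0.
have mphiX n : measurable_fun setT (phi n \o X) by exact: measurableT_comp.
have intphi n : P.-integrable setT (EFin \o (phi n \o X)).
  by apply: bounded_integrable => // w; exact: phi_bnd.
have cvgphi x : (phi n x)%:E @[n --> \oo] --> x%:E.
  apply: cvg_near_cst; near=> n; rewrite phiE//.
  by near: n; exact: nbhs_infty_ger.
have cvg_dist : (\int[P]_w `|(phi n (X w))%:E - (X w)%:E|)%E @[n --> \oo] --> (0 : R)%:E.
  have [//| | | | |] := @dominated_convergence _ _ _ P setT measurableT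
    (fun n w => (phi n (X w))%:E) (EFin \o X) (EFin \o (Num.norm \o X)).
  - by move=> n; exact: (measurable_int _ (intphi n)).
  - exact: (measurable_int _ intX).
  - by apply: aeW => w _; exact: cvgphi.
  - exact: integrable_norm.
  - by apply: aeW => w n _; rewrite /= lee_fin; exact: phi_le.
  - by [].
(* One half of [delta] pays for the truncation error, the other for the shift [m - c] of the mean,
   which is at most that error. *)
have [n Hn] : exists n, \int[P]_w `|X w - phi n (X w)| <= delta / 2.
  have /fine_cvgP[_ /cvgrPdist_lt/(_ _ (divr_gt0 delta0 (ltr0Sn _ 1)))] := cvg_dist.
  case=> n _ /(_ n (leqnn _)); rewrite sub0r normrN => /ltW Hn; exists n.
  apply: le_trans Hn; rewrite (le_trans _ (ler_norm _))//.
  rewrite le_eqVlt; apply/orP; left; apply/eqP; congr fine.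
  by apply: eq_integral => w _; rewrite /= distrC.
pose c := \int[P]_w phi n (X w); pose m := \int[P]_w X w.
have intd : P.-integrable setT (EFin \o (fun w => X w - phi n (X w))).
  exact: (integrableB measurableT intX (intphi n)).
have intcst r : P.-integrable setT (EFin \o (fun=> r)).
  exact: (@bounded_integrable _ _ _ _ _ `|r|).
have mcE : m - c = \int[P]_w (X w - phi n (X w)) by rewrite RintegralB//; exact: intphi.
have mc : `|m - c| <= delta / 2.
  by rewrite mcE (le_trans _ Hn)//; exact: le_normr_Rintegral.
have intq : P.-integrable setT (EFin \o (fun w => X w - phi n (X w) - (m - c))).
  exact: (integrableB measurableT intd (intcst _)).
exists (n%:R + `|c|), (fun x => phi n x - c), (fun x => x - phi n x - (m - c)).
split.
- exact: measurable_funB.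
- by apply: measurable_funB => //; exact: measurable_funB.
- by move=> x; rewrite -/m; ring.
- split; first by move=> x; rewrite (le_trans (ler_normB _ _))// lerD.
  rewrite RintegralB//; last exact: intphi.
  by rewrite -/c Rintegral_probability_cst subrr.
- split => //.
  apply: (@le_trans _ _ (\int[P]_w (`|X w - phi n (X w)| + `|m - c|))).
    apply: le_Rintegral => //.
    + exact: (integrable_norm intq).
    + exact: (integrableD measurableT (integrable_norm intd) (intcst _)).
    + by move=> w _; rewrite ler_normB.
  rewrite RintegralD//; last exact: (integrable_norm intd).
  rewrite Rintegral_probability_cst [leRHS]splitr.
  exact: lerD.
Unshelve. all: by end_near.
Qed.

End truncation.

(** * Convergence in distribution to a constant along a subsequence *)

Section subsequence.
Context d (Omega : measurableType d) (R : realType) (P : probability Omega R).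

(** The limit cdf is a unit step at [c]. On either side of [c], the event on which [S k] falls on
    the wrong side of [x] forces a deviation of at least [|x - c|], which eventually exceeds
    [k.+1%:R^-1]. *)
Lemma cvg_in_distribution_cst (S : nat -> {RV P >-> R}) (c : R) :
  (forall k, P [set w | (k.+1%:R^-1 <= `|S k w - c|)%R] <= (k.+1%:R^-1)%:E)%E ->
  cvg_in_distribution S (cst c : {RV P >-> R}).
Proof.
move=> HS x.
have cdf_lt y : y < c -> cdf (cst c : {RV P >-> R}) y = 0%E.
  move=> yc; rewrite /cdf/distribution/= /pushforward preimage_cst ifF ?measure0//.
  by apply/negbTE; rewrite notin_setE/= in_itv/=; apply/negP; rewrite -ltNge.
have cdf_ge y : c <= y -> cdf (cst c : {RV P >-> R}) y = 1%E.
  move=> yc; rewrite /cdf/distribution/= /pushforward preimage_cst ifT ?probability_setT//.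
  by rewrite inE/= in_itv/=.
have mdev k (e : R) : measurable [set w | e <= `|S k w - c|].
  rewrite -[X in measurable X]setTI; apply: measurable_fun_le => //.
  by apply: measurableT_comp => //; exact: measurable_funB.
have Ple A B : measurable A -> measurable B -> A `<=` B -> (P A <= P B)%E.
  by move=> mA mB AB; rewrite le_measure ?inE.
have inv0 : (k.+1%:R^-1)%:E @[k --> \oo] --> (0 : R)%:E.
  by apply: cvg_EFin; [exact: nearW|exact: cvg_harmonic].
have [xc|cx|->] := ltgtP x c.
- have cx0 : 0 < c - x by rewrite subr_gt0.
  rewrite cdf_lt// => _.
  apply: (@squeeze_cvge _ _ _ _ (cst 0%E) _ (fun k => (k.+1%:R^-1)%:E)) => //; last exact: cvg_cst.
  near=> k; rewrite cdf_ge0/= (le_trans _ (HS k))//; apply: Ple => //.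
    by rewrite -[X in measurable X]setTI; exact: measurable_funP.
  move=> w /=; rewrite in_itv/= => Sx; rewrite distrC.
  rewrite (le_trans _ (ler_norm _))// (le_trans _ (lerB (lexx c) Sx))// ltW//.
  by near: k; exact: (near_infty_natSinv_lt (PosNum cx0)).
- have cx0 : 0 < x - c by rewrite subr_gt0.
  rewrite cdf_ge ?ltW// => _.
  apply: (@squeeze_cvge _ _ _ _ (fun k => 1 - (k.+1%:R^-1)%:E)%E _ (cst 1%E)) => //; last exact: cvg_cst.
    near=> k; rewrite cdf_le1 andbT.
    have mSx : measurable (S k @^-1` `]-oo, x]).
      by rewrite -[X in measurable X]setTI; exact: measurable_funP.
    rewrite leeBlDr// (_ : 1%E = P (S k @^-1` `]-oo, x]) + P (~` (S k @^-1` `]-oo, x])))%E; last first.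
      by rewrite probability_setC// addeC subeK// fin_num_measure.
    rewrite leeD2l// (le_trans _ (HS k))//; apply: Ple => //; first exact: measurableC.
    move=> w /=; rewrite in_itv/= => /negP; rewrite -ltNge => Sx.
    rewrite (le_trans _ (ler_norm _))// (le_trans _ (lerB (ltW Sx) (lexx c)))// ltW//.
    by near: k; exact: (near_infty_natSinv_lt (PosNum cx0)).
  rewrite -[X in _ --> X]sube0; apply: cvgeB => //; exact: cvg_cst.
(* At [x = c] the continuity premise is contradictory: the left limit of the cdf is 0, its value is
   1. *)
- move=> cT; exfalso.
  have : cdf (cst c : {RV P >-> R}) y @[y --> c^'-] --> 1%E.
    by rewrite -(cdf_ge _ (lexx c)); exact: cvg_at_left_filter cT.
  have : cdf (cst c : {RV P >-> R}) y @[y --> c^'-] --> 0%E.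
    apply: cvg_near_cst; near=> y; apply: cdf_lt.
    by near: y; exact: nbhs_left_lt.
  by move=> /(cvg_unique _) /[apply] => /(_ (@ereal_hausdorff _))/eqP; rewrite eq_sym onee_eq0.
Unshelve. all: by end_near.
Qed.

Lemma subsequence_cvg_in_distribution_cst (S : nat -> {RV P >-> R}) (c : R) :
  (forall (N : nat) (e : R), 0 < e -> exists2 n, (N <= n)%N &
     (P [set w | (e <= `|S n w - c|)%R] <= e%:E)%E) ->
  exists2 phi : nat -> nat, {homo phi : m n / (m < n)%N} &
    cvg_in_distribution (fun k => S (phi k)) (cst c : {RV P >-> R}).
Proof.
move=> HS.
have /choice[f Hf] (Nk : nat * nat) : exists n, (Nk.1 <= n)%N /\
    (P [set w | (Nk.2.+1%:R^-1 <= `|S n w - c|)%R] <= (Nk.2.+1%:R^-1)%:E)%E.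
  by have [|n] := HS Nk.1 Nk.2.+1%:R^-1; [rewrite invr_gt0|exists n].
(* Searching from [(phi k').+1] on makes [phi] strictly increasing; the second component sets the
   tolerance of term [k] to [k.+1%:R^-1]. *)
pose phi := fix phi k := if k is k'.+1 then f ((phi k').+1, k) else f (0%N, 0%N).
exists phi.
  by apply: homo_ltn => [? ? ?|k]; [exact: ltn_trans|have [] := Hf ((phi k).+1, k.+1)].
apply: cvg_in_distribution_cst => -[|k].
  by have [] := Hf (0%N, 0%N).
by have [] := Hf ((phi k).+1, k.+1).
Qed.

End subsequence.

(** * Truncation of the weights *)

(** Negative values are cut off too: the weights are nonnegative only almost surely, whereas their
    truncations lie in [[0, x]] everywhere. *)
Definition truncate (R : realType) (x y : R) : R := y * \1_(`[0, x]%classic) y.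

Section truncate.
Context (R : realType) (x : R).
Hypothesis x0 : 0 <= x.

Lemma measurable_truncate : measurable_fun setT (truncate x).
Proof. by apply: measurable_funM => //; exact: measurable_indic. Qed.

Lemma truncate_id y : 0 <= y <= x -> truncate x y = y.
Proof. by move=> yx; rewrite /truncate indicE mem_set ?mulr1//= in_itv/=. Qed.

Lemma truncate_out y : ~~ (0 <= y <= x) -> truncate x y = 0.
Proof.
by move=> yx; rewrite /truncate indicE memNset ?mulr0//= in_itv/=; exact/negP.
Qed.

Lemma truncate_bound y : 0 <= truncate x y <= x.
Proof.
have [/[dup] ? /truncate_id ->//|/truncate_out ->] := boolP (0 <= y <= x).
by rewrite lexx.
Qed.

End truncate.

(** * Deviation bound for the weighted mean at a fixed sample size and truncation level *)

Section weighted_mean_deviation.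
Context d (Omega : measurableType d) (R : realType) (P : probability Omega R).

Lemma union_bound_ord (n : nat) (B : nat -> set Omega) (p : R) :
  (forall i, measurable (B i)) -> (forall i, P (B i) <= p%:E)%E ->
  (P (\big[setU/set0]_(i < n) B i) <= (n%:R * p)%:E)%E.
Proof.
move=> mB PB; apply: (le_trans (Boole_inequality P (fun i _ => mB i))).
apply: (@le_trans _ _ (\sum_(i < n) p%:E)%E); first by apply: lee_sum => i _; exact: PB.
by rewrite sumEFin sumr_const card_ord mulr_natl.
Qed.

(** The variance formula; it bounds the variance of a truncated weight and, by nonnegativity of the
    left side, the square of its mean. *)
Lemma Rintegral_centered_sqr (f : Omega -> R) (K : R) :
  measurable_fun setT f -> (forall w, `|f w| <= K) ->
  \int[P]_w ((f w - \int[P]_v f v) ^+ 2) =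
  \int[P]_w (f w ^+ 2) - (\int[P]_w f w) ^+ 2.
Proof.
move=> mf fK; set a := \int[P]_v f v.
have intf := bounded_integrable P mf fK.
have intf2 : P.-integrable setT (EFin \o (fun w => f w ^+ 2)).
  apply: (@bounded_integrable _ _ _ _ _ (K ^+ 2)); first exact: measurable_funX.
  by move=> w; rewrite normrX lerXn2r// nnegrE (le_trans _ (fK w)).
have intaf : P.-integrable setT (EFin \o (fun w => 2 * a * f w)).
  exact: (integrableZl measurableT _ intf).
have inta2 : P.-integrable setT (EFin \o (fun=> a ^+ 2)).
  exact: (@bounded_integrable _ _ _ _ _ `|a ^+ 2|).
rewrite (@eq_Rintegral _ _ _ P setT
  (fun w => f w ^+ 2 - 2 * a * f w + a ^+ 2)); last first.
  by move=> w _; ring.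
rewrite RintegralD//; last exact: (integrableB measurableT intf2 intaf).
rewrite RintegralB// RintegralZl// Rintegral_probability_cst -/a.
by ring.
Qed.

Variables (X Y : {RV P >-> R}) (X_ Y_ : nat -> {RV P >-> R}).
Hypothesis XY : independent2 X Y.
Hypothesis iid : iid_copies (fun i => pairRV (X_ i) (Y_ i)) (pairRV X Y).

Variables (x D K delta eps : R) (u q : R -> R) (n : nat).
Hypotheses (x0 : 0 < x) (eps0 : 0 < eps) (n0 : (0 < n)%N).
Let m := \int[P]_w X w.
Let a := \int[P]_w truncate x (Y w).
Hypothesis a0 : 0 < a.
Hypothesis second_le : \int[P]_w (truncate x (Y w) ^+ 2) <= D.
Hypothesis tail_le : (P [set w | ~~ (0 <= Y w <= x)%R] <= (D / x ^+ 2)%:E)%E.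
Hypotheses (mu : measurable_fun setT u) (mq : measurable_fun setT q).
Hypothesis Xuq : forall z, z - m = u z + q z.
Hypotheses (uK : forall z, `|u z| <= K) (u0 : \int[P]_w u (X w) = 0).
Hypothesis intq : P.-integrable setT (EFin \o (q \o X)).
Hypothesis q_le : \int[P]_w `|q (X w)| <= delta.

Let g := truncate x.
Let mg : measurable_fun setT g. Proof. exact: measurable_truncate. Qed.
Let g0 y : 0 <= g y. Proof. by have /andP[] := truncate_bound (ltW x0) y. Qed.
Let gx y : g y <= x. Proof. by have /andP[] := truncate_bound (ltW x0) y. Qed.
Let g_norm y : `|g y| <= x. Proof. by rewrite ger0_norm. Qed.
Let mgY : measurable_fun setT (g \o Y). Proof. exact: measurableT_comp. Qed.
Let intg : P.-integrable setT (EFin \o (g \o Y)).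
Proof. by apply: (@bounded_integrable _ _ _ _ _ x) => // w; exact: g_norm. Qed.
Let intg2 : P.-integrable setT (EFin \o (fun w => g (Y w) ^+ 2)).
Proof.
apply: (@bounded_integrable _ _ _ _ _ (x ^+ 2)).
  exact: measurable_funX.
by move=> w; rewrite normrX lerXn2r// nnegrE// ltW.
Qed.
Let t0 : 0 < n%:R * a.
Proof. by rewrite mulr_gt0// ltr0n. Qed.

Let bad_range :
  (P (\big[setU/set0]_(i < n) [set w | ~~ (0 <= Y_ i w <= x)%R]) <=
   (n%:R * (D / x ^+ 2))%:E)%E.
Proof.
have mC : measurable (~` `[0, x]%classic : set R) by exact: measurableC.
have preE (V : {RV P >-> R}) :
    [set w | ~~ (0 <= V w <= x)%R] = V @^-1` (~` `[0, x]%classic).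
  by apply/seteqP; split => w /=; rewrite in_itv/= => /negP.
apply: (@union_bound_ord n (fun i => [set w | ~~ (0 <= Y_ i w <= x)%R])) => i.
  by rewrite preE -[X in measurable X]setTI; exact: measurable_funP.
apply: le_trans tail_le.
(* Identical distribution is given for the pairs only, so the event on [Y_ i] is read as a rectangle
   with full first side. *)
have [_ /(_ i (setT `*` ~` `[0, x]%classic))] := iid.
rewrite /distribution/= /pushforward/= => E.
rewrite !preE le_eqVlt; apply/orP; left; apply/eqP.
rewrite (_ : Y_ i @^-1` _ = (fun w => (X_ i w, Y_ i w)) @^-1` (setT `*` ~` `[0, x]%classic)).
  rewrite E; last exact: measurableX.
  by congr (P _); apply/seteqP; split=> w //= [].
by apply/seteqP; split=> w //= [].
Qed.

(** Chebyshev's inequality with variance at most [D]. The threshold is half the expected total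
    [n a], so that off this event the total truncated weight exceeds [n a / 2]. *)
Let bad_weight :
  (P [set w | (n%:R * a / 2 <= `|\sum_(i < n) (g (Y_ i w) - a)|)%R] <=
   (4 * D / (n%:R * a ^+ 2))%:E)%E.
Proof.
have := @iid_sum_deviation _ _ _ _ _ _ _ _ (fun z => g z.2 - a) (x + `|a|) n
  (n%:R * a / 2) iid.
rewrite /= => H; apply: (le_trans (H _ _ _ _)).
- apply: measurable_funB => //; exact: (measurableT_comp mg).
- by move=> z; rewrite (le_trans (ler_normB _ _))// lerD.
- by rewrite RintegralB// ?Rintegral_probability_cst ?subrr//;
    exact: (@bounded_integrable _ _ _ _ _ `|a|).
- by rewrite divr_gt0.
rewrite lee_fin.
have -> : \int[P]_w ((g (Y w) - a) ^+ 2) = \int[P]_w (g (Y w) ^+ 2) - a ^+ 2.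
  exact: (Rintegral_centered_sqr mgY (fun w => g_norm (Y w))).
rewrite (_ : _ / _ = 4 * (\int[P]_w (g (Y w) ^+ 2) - a ^+ 2) / (n%:R * a ^+ 2)); last first.
  by field; rewrite !gt_eqF//= ltr0n.
rewrite ler_pM2r ?invr_gt0 ?mulr_gt0 ?ltr0n ?exprn_gt0// ler_pM2l//.
by rewrite (le_trans _ second_le)// gerBl sqr_ge0.
Qed.

(** By independence the terms have mean [E u(X) E g(Y) = 0] and second moment at most [K ^+ 2 * D].
    The threshold is half of [eps] times the lower bound [n a / 2] on the total weight; the other
    half is left to the remainder. *)
Let bad_centered :
  (P [set w | (eps * (n%:R * a) / 4 <= `|\sum_(i < n) (u (X_ i w) * g (Y_ i w))|)%R] <=
   (16 * K ^+ 2 * D / (eps ^+ 2 * (n%:R * a ^+ 2)))%:E)%E.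
Proof.
have := @iid_sum_deviation _ _ _ _ _ _ _ _ (fun z => u z.1 * g z.2) (K * x) n
  (eps * (n%:R * a) / 4) iid.
rewrite /= => H; apply: (le_trans (H _ _ _ _)).
- by apply: measurable_funM; [exact: (measurableT_comp mu)|exact: (measurableT_comp mg)].
- by move=> z; rewrite normrM ler_pM.
- rewrite (independent_RintegralM XY)// ?u0 ?mul0r//.
  apply: (@bounded_integrable _ _ _ _ _ K) => //.
    exact: measurableT_comp.
  by move=> w; exact: uK.
- by rewrite divr_gt0// mulr_gt0.
rewrite lee_fin.
have K0 : 0 <= K by rewrite (le_trans _ (uK 0)).
have : \int[P]_w ((u (X w) * g (Y w)) ^+ 2) <= K ^+ 2 * D.
  apply: (@le_trans _ _ (\int[P]_w (K ^+ 2 * g (Y w) ^+ 2))).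
    apply: le_Rintegral => //.
    - apply: (@bounded_integrable _ _ _ _ _ ((K * x) ^+ 2)).
        apply: measurable_funX; apply: measurable_funM => //.
        exact: measurableT_comp.
      move=> w; rewrite normrX lerXn2r ?nnegrE ?mulr_ge0 ?(ltW x0)//.
      by rewrite normrM ler_pM.
    - exact: (integrableZl measurableT _ intg2).
    - move=> w _; rewrite exprMn ler_wpM2r ?sqr_ge0//.
      by rewrite -[u _ ^+ 2]real_normK ?num_real// lerXn2r// nnegrE.
  by rewrite RintegralZl// ler_wpM2l ?sqr_ge0.
move=> VD.
rewrite (_ : _ / _ = 16 * (\int[P]_w ((u (X w) * g (Y w)) ^+ 2)) / (eps ^+ 2 * (n%:R * a ^+ 2))); last first.
  by field; rewrite !gt_eqF//= ltr0n.
rewrite ler_pM2r; last by rewrite invr_gt0 !mulr_gt0 ?ltr0n ?exprn_gt0.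
by rewrite -mulrA ler_pM2l.
Qed.

(** Since [q] is controlled in L^1 only, Markov's inequality replaces Chebyshev's. By independence
    the sum has mean [n E|q(X)| a], and [n a] cancels against the threshold. *)
Let bad_remainder :
  (P [set w | (eps * (n%:R * a) / 4 <= \sum_(i < n) (`|q (X_ i w)| * g (Y_ i w)))%R] <=
   (4 * delta / eps)%:E)%E.
Proof.
pose h (z : R * R) := `|q z.1| * g z.2.
have mnq : measurable_fun setT (fun z => `|q z|) by exact: measurableT_comp.
have mh : measurable_fun setT h.
  by apply: measurable_funM; [exact: (measurableT_comp mnq)|exact: (measurableT_comp mg)].
have inth : P.-integrable setT (EFin \o (h \o pairRV X Y)).
  exact: (independent_integrableM XY mnq mg (integrable_norm intq) intg).
have [_ iden] := iid.
have inthi i := identically_distributed_integrable (iden i) mh inth.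
have ints : P.-integrable setT
    (EFin \o (fun w => \sum_(i < n) (`|q (X_ i w)| * g (Y_ i w)))).
  rewrite (_ : _ \o _ = (fun w => \sum_(i < n) (h (pairRV (X_ i) (Y_ i) w))%:E)%E).
    by apply: integrable_sum => // i _; exact: inthi.
  by apply/funext => w /=; rewrite sumEFin.
apply: (le_trans (markov_Rintegral ints _ _)).
- by move=> w; apply: sumr_ge0 => i _; rewrite mulr_ge0.
- by rewrite divr_gt0// mulr_gt0.
rewrite lee_fin.
have -> : \int[P]_w (\sum_(i < n) (`|q (X_ i w)| * g (Y_ i w))) =
    n%:R * ((\int[P]_w `|q (X w)|) * a).
  rewrite (@Rintegral_sum _ _ _ _ _ _ (fun (i : 'I_n) w => h (pairRV (X_ i) (Y_ i) w))); last first.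
    by move=> i; exact: inthi.
  under eq_bigr => i _ do rewrite (identically_distributed_Rintegral (iden i) mh inth).
  rewrite sumr_const card_ord mulr_natl; congr (_ *+ n).
  exact: (independent_RintegralM XY mnq mg (integrable_norm intq) intg).
rewrite (_ : _ / _ = 4 * (\int[P]_w `|q (X w)|) / eps); last first.
  by field; rewrite !gt_eqF//= ltr0n.
by rewrite ler_pM2r ?invr_gt0// ler_pM2l.
Qed.

(** When no weight is altered by truncation, the error is a quotient whose numerator is below
    [eps * (n a / 2)] in absolute value and whose denominator [S] exceeds [n a / 2]; in particular
    [S] is nonzero. *)
Let near_mean w :
  (forall i : 'I_n, 0 <= Y_ i w <= x) ->
  `|\sum_(i < n) (g (Y_ i w) - a)| < n%:R * a / 2 ->
  `|\sum_(i < n) (u (X_ i w) * g (Y_ i w))| < eps * (n%:R * a) / 4 ->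
  \sum_(i < n) (`|q (X_ i w)| * g (Y_ i w)) < eps * (n%:R * a) / 4 ->
  `|weighted_mean (fun i => X_ i) (fun i => Y_ i) n w - m| < eps.
Proof.
move=> Yx dW dU dQ.
have gY (i : 'I_n) : g (Y_ i w) = Y_ i w by apply: truncate_id; exact: Yx.
pose S := \sum_(i < n) Y_ i w.
have S_gt : n%:R * a / 2 < S.
  move: dW; rewrite sumrB sumr_const card_ord -mulr_natl => /ltr_normlP[+ _].
  by under eq_bigr do rewrite gY; rewrite -/S; lra.
have S0 : 0 < S by rewrite (lt_trans _ S_gt)// divr_gt0.
have -> : weighted_mean (fun i => X_ i) (fun i => Y_ i) n w - m =
    (\sum_(i < n) (u (X_ i w) * g (Y_ i w)) +
     \sum_(i < n) (q (X_ i w) * g (Y_ i w))) / S.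
  rewrite -big_split/= /weighted_mean -/S.
  under [in RHS]eq_bigr do rewrite -mulrDl -Xuq gY mulrBl.
  by rewrite sumrB -mulr_sumr -/S mulrBl mulfK ?gt_eqF.
rewrite normrM normfV (gtr0_norm S0) ltr_pdivrMr//.
have dQ' : `|\sum_(i < n) (q (X_ i w) * g (Y_ i w))| < eps * (n%:R * a) / 4.
  apply: le_lt_trans dQ; apply: (le_trans (ler_norm_sum _ _ _)).
  by apply: ler_sum => i _; rewrite normrM (ger0_norm (g0 _)).
have : eps * (n%:R * a / 2) < eps * S by rewrite ltr_pM2l.
have := ler_normD (\sum_(i < n) (u (X_ i w) * g (Y_ i w))) (\sum_(i < n) (q (X_ i w) * g (Y_ i w))).
lra.
Qed.

(** The four terms bound, in order, the probabilities of the bad events for the range, the total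
    weight, the bounded centered part and the remainder; off their union [near_mean] applies. *)
Lemma weighted_mean_deviation :
  (P [set w | (eps <= `|weighted_meanRV X_ Y_ n w - m|)%R] <=
   (n%:R * (D / x ^+ 2) + 4 * D / (n%:R * a ^+ 2) +
    16 * K ^+ 2 * D / (eps ^+ 2 * (n%:R * a ^+ 2)) + 4 * delta / eps)%:E)%E.
Proof.
have := bad_range; set B0 := \big[setU/set0]_(i < n) _ => PB0.
have := bad_weight; set B1 := [set w | _] => PB1.
have := bad_centered; set B2 := [set w | _] => PB2.
have := bad_remainder; set B3 := [set w | _] => PB3.
have mB0 : measurable B0.
  apply: bigsetU_measurable => i _.
  rewrite (_ : [set w | _] = Y_ i @^-1` (~` `[0, x]%classic)); last first.
    by apply/seteqP; split => w /=; rewrite in_itv/= => /negP.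
  by rewrite -[X in measurable X]setTI; apply: measurable_funP => //; exact: measurableC.
have mXi i : measurable_fun setT (u \o X_ i) by exact: measurableT_comp.
have mqXi i : measurable_fun setT (q \o X_ i) by exact: measurableT_comp.
have mYi i : measurable_fun setT (g \o Y_ i) by exact: measurableT_comp.
have mge (f : Omega -> R) e : measurable_fun setT f -> measurable [set w | e <= f w].
  by move=> mf; rewrite -[X in measurable X]setTI; exact: measurable_fun_le.
have mB1 : measurable B1.
  apply: mge; apply: measurableT_comp => //; apply: measurable_sum => i.
  by apply: measurable_funB => //; exact: mYi.
have mB2 : measurable B2.
  apply: mge; apply: measurableT_comp => //; apply: measurable_sum => i.
  by apply: measurable_funM; [exact: mXi|exact: mYi].
have mB3 : measurable B3.
  apply: mge; apply: measurable_sum => i.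
  apply: measurable_funM; last exact: mYi.
  by apply: measurableT_comp => //; exact: mqXi.
have mdev : measurable [set w | eps <= `|weighted_meanRV X_ Y_ n w - m|].
  by apply: mge; apply: measurableT_comp => //; exact: measurable_funB.
have mB01 := measurableU _ _ mB0 mB1.
have mB012 := measurableU _ _ mB01 mB2.
apply: (@le_trans _ _ (P (B0 `|` B1 `|` B2 `|` B3))).
  apply: le_measure; rewrite ?inE//; first exact: measurableU.
  move=> w /= dev; apply: contrapT => /not_orP[/not_orP[/not_orP[nB0 nB1] nB2] nB3].
  move: dev; apply/negP; rewrite -ltNge; apply: near_mean.
  - move=> i; apply: contrapT => /negP Yi; apply: nB0.
    by rewrite /B0 -(bigcup_mkord n (fun i => [set w | ~~ (0 <= Y_ i w <= x)])); exists i => /=.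
  - by rewrite ltNge; exact/negP.
  - by rewrite ltNge; exact/negP.
  - by rewrite ltNge; exact/negP.
rewrite !EFinD; apply: (le_trans (measureU2 P _ _)) => //; apply: leeD => //.
apply: (le_trans (measureU2 P _ _)) => //; apply: leeD => //.
by apply: (le_trans (measureU2 P _ _)) => //; apply: leeD.
Qed.

End weighted_mean_deviation.

(** * Large values of the truncation ratio and the sample size they allow *)

Section truncation_ratio.
Context d (Omega : measurableType d) (R : realType) (P : probability Omega R).
Variable Y : {RV P >-> R}.

(** The half-line []0, +oo[] is a neighbourhood of infinity, so a bound [C] on it would bound the
    limsup, an infimum over such neighbourhoods. *)
Lemma truncation_ratio_unbounded (C : R) : ~ ratio_limsup_finite Y ->
  exists2 x, 0 < x & C < truncation_ratio Y x.
Proof.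
move=> Yoo; apply: contrapT => bounded; apply: Yoo.
rewrite /ratio_limsup_finite limf_esupE.
apply: (@le_lt_trans _ _ C%:E); last exact: ltry.
apply: (@le_trans _ _ (ereal_sup ((fun x => (truncation_ratio Y x)%:E) @` `]0, +oo[%classic))).
  apply: ereal_inf_lbound; exists `]0, +oo[%classic => //.
  near=> x => /=; rewrite in_itv/= andbT.
  by near: x; exact: nbhs_pinfty_gt.
apply: ge_ereal_sup => _ [x /= + <-]; rewrite in_itv/= andbT => x0.
by rewrite lee_fin leNgt; apply/negP => Cx; apply: bounded; exists x.
Unshelve. all: by end_near.
Qed.

Hypothesis Y_ge0 : P [set w | (0 <= Y w)%R] = 1%E.

Let mY0 : measurable [set w | (0 <= Y w)%R].
Proof. by rewrite -[X in measurable X]setTI; exact: measurable_fun_le. Qed.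

Let Y_lt0E : [set w | (Y w < 0)%R] = ~` [set w | (0 <= Y w)%R].
Proof. by apply/seteqP; split => w /=; rewrite ltNge => /negP. Qed.

Let mYlt0 : measurable [set w | (Y w < 0)%R].
Proof. by rewrite Y_lt0E; exact: measurableC. Qed.

Let Y_lt0 : P [set w | (Y w < 0)%R] = 0%E.
Proof.
by rewrite Y_lt0E probability_setC// Y_ge0 subee.
Qed.

Let mYx x : measurable [set w | (Y w <= x)%R].
Proof. by rewrite -[X in measurable X]setTI; exact: measurable_fun_le. Qed.

(** The integrands can differ only on the null set where [Y < 0]; where [Y > x] both vanish, thanks
    to [f 0 = 0]. *)
Let ae_truncate (x : R) (f : R -> R) : measurable_fun setT f -> f 0 = 0 ->
  fine 'E_P[fun w => f (Y w) * \1_[set v | Y v <= x] w] =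
  \int[P]_w f (truncate x (Y w)).
Proof.
move=> mf f0; rewrite /Rintegral unlock; congr fine; apply: ae_eq_integral => //.
- apply/measurable_EFinP; apply: measurable_funM; last exact: measurable_indic.
  exact: (measurableT_comp mf).
- apply/measurable_EFinP; apply: (measurableT_comp mf).
  by apply: measurableT_comp => //; exact: measurable_truncate.
- exists [set w | (Y w < 0)%R]; split => //.
  move=> w /= H; rewrite ltNge; apply/negP => Yw; apply: H => _.
  rewrite indicE; have [Yx|xY] := leP (Y w) x.
    by rewrite mem_set// mulr1 truncate_id ?Yw.
  by rewrite memNset ?truncate_out ?Yw ?f0 ?mulr0//= -?ltNge// => /(lt_le_trans xY); rewrite ltxx.
Qed.

(** [D] is the denominator of the ratio. Each of its two nonnegative summands is at most [D], which
    yields the second moment bound and the tail bound; the negative values of [Y] add a null set to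
    the tail. *)
Lemma truncation_ratioE x : 0 < x -> exists D : R,
  [/\ truncation_ratio Y x = x * (\int[P]_w truncate x (Y w)) / D,
      0 <= D, \int[P]_w (truncate x (Y w) ^+ 2) <= D &
      (P [set w | ~~ (0 <= Y w <= x)%R] <= (D / x ^+ 2)%:E)%E].
Proof.
move=> x0.
have E1 := @ae_truncate x id (@measurable_id _ _ _) erefl.
have E2 := @ae_truncate x (fun y => y ^+ 2) (measurable_funX 2 (@measurable_id _ _ _)) (expr0n R 2).
exists (x ^+ 2 * fine (P [set w | Y w > x]) + \int[P]_w (truncate x (Y w) ^+ 2)).
have D2 : 0 <= \int[P]_w (truncate x (Y w) ^+ 2).
  by apply: Rintegral_ge0 => w _; exact: sqr_ge0.
have D1 : 0 <= x ^+ 2 * fine (P [set w | Y w > x]).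
  by rewrite mulr_ge0 ?sqr_ge0// fine_ge0.
have mYgt : measurable [set w | (Y w > x)%R].
  rewrite (_ : [set w | _] = ~` [set w | (Y w <= x)%R]); first exact: measurableC.
  by apply/seteqP; split => w /=; rewrite ltNge => /negP.
split.
- by rewrite /truncation_ratio E1 E2.
- exact: addr_ge0.
- by rewrite lerDr.
- rewrite (_ : [set w | _] = [set w | (Y w < 0)%R] `|` [set w | (Y w > x)%R]).
    apply: (le_trans (measureU2 P _ _)) => //.
    rewrite [X in (X + _)%E](_ : _ = 0%E) ?add0e//.
    rewrite -[leLHS]fineK ?fin_num_measure// lee_fin ler_pdivlMr ?exprn_gt0//.
    by rewrite mulrC lerDl.
  apply/seteqP; split => w /=; rewrite negb_and -!ltNge.
    by move=> /orP[]; [left|right].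
  by move=> -[->//|->]; rewrite orbT.
Qed.

End truncation_ratio.

(** [n] is [y = c x^2 / D] rounded up to a strictly larger integer. With [r = x a / D] one has
    [y a^2 / D = c r^2], hence [y >= c r^2] because [a^2 <= D]. *)
Lemma sample_size (R : realType) (x a D c : R) : 0 < x -> 0 < a -> 0 < D ->
  0 < c -> a ^+ 2 <= D -> 1 <= c * (x * a / D) ^+ 2 ->
  exists n : nat, [/\ c * (x * a / D) ^+ 2 <= n%:R,
    n%:R * (D / x ^+ 2) <= 2 * c &
    D / (n%:R * a ^+ 2) <= (c * (x * a / D) ^+ 2)^-1].
Proof.
move=> x0 a0 D0 c0 aD cr1.
pose y := c * x ^+ 2 / D.
have y0 : 0 < y by rewrite divr_gt0// mulr_gt0// exprn_gt0.
have cry : c * (x * a / D) ^+ 2 = y * (a ^+ 2 / D).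
  by rewrite /y; field; rewrite gt_eqF.
have cr_le_y : c * (x * a / D) ^+ 2 <= y.
  by rewrite cry ger_pMr// ler_pdivrMr// mul1r.
exists (Num.truncn y).+1.
have /andP[] := truncn_itv (ltW y0); set n := (Num.truncn y).+1 => le_y y_n.
(* Here [y >= 1], by [cr1] and [cr_le_y], so adding 1 at most doubles [y]. *)
have n2y : n%:R <= 2 * y by rewrite /n -natr1; lra.
split.
- by rewrite (le_trans cr_le_y)// ltW.
- apply: (@le_trans _ _ (2 * y * (D / x ^+ 2))).
    by rewrite ler_pM2r// divr_gt0// exprn_gt0.
  by rewrite le_eqVlt; apply/orP; left; apply/eqP; rewrite /y; field; rewrite !gt_eqF.
- rewrite cry [leRHS](_ : _ = D / (y * a ^+ 2)); last by field; rewrite !gt_eqF.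
  rewrite ler_pM2l// lef_pV2 ?posrE ?(mulr_gt0 y0) ?mulr_gt0 ?exprn_gt0 ?ltr0n//.
  by rewrite ler_pM2r ?exprn_gt0// ltW.
Qed.

(** * Closeness to the mean in probability at arbitrarily late indices, and the conclusion *)

Section consistency.
Context d (Omega : measurableType d) (R : realType) (P : probability Omega R).
Variables (X Y : {RV P >-> R}) (X_ Y_ : nat -> {RV P >-> R}).
Hypothesis XY : independent2 X Y.
Hypothesis Y_ge0 : P [set w | (0 <= Y w)%R] = 1%E.
Hypothesis iid : iid_copies (fun i => pairRV (X_ i) (Y_ i)) (pairRV X Y).
Hypothesis intX : P.-integrable setT (EFin \o X).
Hypothesis ratio_oo : ~ ratio_limsup_finite Y.

Lemma weighted_mean_frequently_close (N : nat) (e : R) : 0 < e ->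
  exists2 n, (N <= n)%N &
    (P [set w | (e <= `|weighted_meanRV X_ Y_ n w - \int[P]_v X v|)%R] <= e%:E)%E.
Proof.
move=> e0.
(* Each of the four terms of the deviation bound is allotted [e / 4]. This [delta] gives
   [4 * delta / e = e / 4], and [c = e / 8] below gives [2 * c = e / 4] for the range term. *)
have delta0 : 0 < e ^+ 2 / 16 by rewrite divr_gt0// exprn_gt0.
have [K [u [q [mu mq Xuq [uK u0] [intq q_le]]]]] := centered_decomposition intX delta0.
pose c := e / 8; have c0 : 0 < c by rewrite divr_gt0.
(* A lower bound wanted for [n]: [N%:R + 1] makes the index late and positive, [16 / e] serves the
   total weight term, and the last summand the bounded centered term. *)
pose A := N%:R + 1 + 16 / e + 64 * K ^+ 2 / e ^+ 3.
have K2 : 0 <= 64 * K ^+ 2 / e ^+ 3.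
  by apply: divr_ge0; [apply: mulr_ge0 => //; exact: sqr_ge0|exact/exprn_ge0/ltW].
have e16 : 0 < 16 / e by rewrite divr_gt0.
have N0 : 0 <= N%:R :> R by [].
(* The summand 1 gives [r > 1], so [r ^+ 2 >= r] and [c * r ^+ 2 >= A]. *)
have [x x0] := truncation_ratio_unbounded (1 + A / c) ratio_oo.
have [D [-> D0 second_le tail_le]] := truncation_ratioE Y_ge0 x0.
set a := \int[P]_w truncate x (Y w); set r := x * a / D => r_gt.
have A0 : 0 < A by rewrite /A; lra.
have r1 : 1 < r by rewrite (le_lt_trans _ r_gt)// lerDl divr_ge0// ltW.
(* If [D] were 0, the convention [0^-1 = 0] would make [r] vanish, against [r > 1]; the same
   contradiction excludes [a = 0]. *)
have Dgt0 : 0 < D.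
  rewrite lt_neqAle D0 andbT; apply/eqP => D00.
  by move: r1; rewrite /r -D00 invr0 mulr0 ltr10.
have a_ge0 : 0 <= a.
  by apply: Rintegral_ge0 => w _; have /andP[] := truncate_bound (ltW x0) (Y w).
have a0 : 0 < a.
  rewrite lt_neqAle a_ge0 andbT; apply/eqP => a00.
  by move: r1; rewrite /r -a00 mulr0 mul0r ltr10.
(* The variance of the truncated weight is nonnegative. *)
have aD : a ^+ 2 <= D.
  rewrite (le_trans _ second_le)// -subr_ge0.
  rewrite -(@Rintegral_centered_sqr _ _ _ P (truncate x \o Y) x).
  - by apply: Rintegral_ge0 => w _; exact: sqr_ge0.
  - by apply: measurableT_comp => //; exact: measurable_truncate.
  - move=> w /=; have /andP[? ?] := truncate_bound (ltW x0) (Y w).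
    by rewrite ger0_norm.
have cr : A <= c * r ^+ 2.
  rewrite -ler_pdivrMl// mulrC (@le_trans _ _ r)//; first by lra.
  by rewrite expr2 ler_peMr// ltW// (lt_trans ltr01).
have [|n [n_ge nD Dna]] := sample_size x0 a0 Dgt0 c0 aD.
  by rewrite -/r (le_trans _ cr)// /A; lra.
rewrite -/r in n_ge Dna.
have Nn : N%:R + 1 <= n%:R :> R by rewrite (le_trans _ n_ge)// (le_trans _ cr)// /A; lra.
exists n; first by rewrite -(ler_nat R); lra.
have n0 : (0 < n)%N by rewrite -(ltr_nat R); lra.
apply: (le_trans (weighted_mean_deviation XY iid x0 e0 n0 a0 second_le tail_le
  mu mq Xuq uK u0 intq q_le)).
rewrite lee_fin -/a.
have Dna_e : D / (n%:R * a ^+ 2) <= A^-1 by rewrite (le_trans Dna)// lef_pV2 ?posrE// (lt_le_trans A0).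
have H1 : n%:R * (D / x ^+ 2) <= e / 4 by rewrite (le_trans nD)// /c; lra.
have H2 : 4 * D / (n%:R * a ^+ 2) <= e / 4.
  rewrite -mulrA -ler_pdivlMl// (le_trans Dna_e)//.
  rewrite -[leRHS]invrK lef_pV2 ?posrE// ?invr_gt0 ?mulr_gt0 ?invr_gt0//.
  rewrite [leLHS](_ : _ = 16 / e); last by field; rewrite gt_eqF.
  by rewrite /A; lra.
have H3 : 16 * K ^+ 2 * D / (e ^+ 2 * (n%:R * a ^+ 2)) <= e / 4.
  rewrite (_ : _ / _ = 16 * K ^+ 2 / e ^+ 2 * (D / (n%:R * a ^+ 2))); last first.
    by field; rewrite !gt_eqF// ltr0n.
  apply: (@le_trans _ _ (16 * K ^+ 2 / e ^+ 2 * A^-1)).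
    rewrite ler_wpM2l//; apply: divr_ge0; last exact: sqr_ge0.
    by apply: mulr_ge0 => //; exact: sqr_ge0.
  rewrite ler_pdivrMr// (_ : _ / _ = e / 4 * (64 * K ^+ 2 / e ^+ 3)); last first.
    by field; rewrite gt_eqF.
  by rewrite ler_wpM2l ?divr_ge0 ?(ltW e0)// /A; lra.
have H4 : 4 * (e ^+ 2 / 16) / e <= e / 4.
  by rewrite le_eqVlt; apply/orP; left; apply/eqP; field; rewrite gt_eqF.
lra.
Qed.

End consistency.

Theorem theorem5 (R : realType) (d : measure_display) (Omega : measurableType d)
    (P : probability Omega R) (X Y : {RV P >-> R})
    (X_ Y_ : nat -> {RV P >-> R}) :
  independent2 X Y ->
  (0 < P [set w | (0 < Y w)%R] <= P [set w | (0 <= Y w)%R])%E ->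
  P [set w | (0 <= Y w)%R] = 1%E ->
  iid_copies (fun i => pairRV (X_ i) (Y_ i)) (pairRV X Y) ->
  ('E_P[fun w => (`|X w|)%R] < +oo)%E ->
  ~ ratio_limsup_finite Y ->
  exists (phi : nat -> nat) (d' : measure_display)
    (Omega' : measurableType d') (P' : probability Omega' R)
    (T : {RV P' >-> R}),
    [/\ {homo phi : m n / (m < n)%N},
        cvg_in_distribution (fun k => weighted_meanRV X_ Y_ (phi k)) T &
        (0 < P' [set w | (T w)%:E = 'E_P[X]])%E].
Proof.
move=> XY _ Y_ge0 iid EX ratio_oo.
have intX : P.-integrable setT (EFin \o X).
  apply/integrableP; split; first exact/measurable_EFinP.
  by move: EX; rewrite unlock.
have [phi phi_lt cvgT] := subsequence_cvg_in_distribution_cst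
  (weighted_mean_frequently_close XY Y_ge0 iid intX ratio_oo).
(* With the constant limit the event in the conclusion is the whole space; integrability of [X]
   makes its expectation finite, hence equal to this real number. *)
exists phi, d, Omega, P, (cst (\int[P]_w X w)); split => //.
rewrite [X in P X](_ : _ = setT) ?probability_setT//.
apply/seteqP; split => w //= _.
rewrite unlock /Rintegral fineK//; exact: integrable_fin_num.
Qed.
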